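(* Let $\alpha,\beta\in\mathbb{R}$ with $|\alpha|\neq|\beta|$, and let $p\in\mathbb{N}$ be odd. Then the improper integral $$\mathcal{I}_{p,1}(\alpha,\beta)=\int_0^\infty\frac{(\cos\alpha x-\cos\beta x)^p}{x}\,dx$$ diverges if and only if either $|\alpha/\beta|\in\mathcal{F}_p$ or $|\beta/\alpha|\in\mathcal{F}_p$.
   Context: $\mathbb{N}=\{1,2,3,\ldots\}$. The integral is an improper (Riemann) integral at both endpoints: it converges if $\int_\varepsilon^R$ of the integrand tends to a finite limit as $\varepsilon\to0^+$ and $R\to\infty$ independently, and it diverges otherwise. Let $b\in\mathbb{N}$ be odd and $a\in\{0,1,\ldots,b-1\}$. Put $m_{a,b}:=\max\{0,a-(b-1)/2\}$ and $$\mathcal{R}_{a,b}:=\left\{a-2k : k\in\mathbb{Z},\ m_{a,b}\le k\le\left\lfloor\tfrac a2\right\rfloor\right\},$$ $$\mathcal{F}_{a,b}:=\left\{\frac rs\in[0,1) : r\in\mathcal{R}_{a,b},\ s\in\{r+1,r+3,\ldots,b-a\}\right\},$$ where $\{r+1,r+3,\ldots,b-a\}$ is the set of integers $s$ with $r+1\le s\le b-a$ and $s-r$ odd (empty if $r+1>b-a$). Finally $$\mathcal{F}_b:=\bigcup_{a\in\{0,1,\ldots,(b-1)/2\}}\mathcal{F}_{a,b}.$$ A ratio with zero denominator is regarded as not belonging to $\mathcal{F}_p$. *)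

(* Defs.v *)
From Stdlib Require Import Reals ZArith.
From Coquelicot Require Import Coquelicot.

Open Scope R_scope.

(* Convergence at both endpoints of ]0, +oo[, the two limits being independent
   (product filter). *)
Definition improper_converges (f : R -> R) : Prop :=
  ex_RInt_gen f (at_right 0) (Rbar_locally p_infty).

Definition improper_diverges (f : R -> R) : Prop := ~ improper_converges f.

(* The sets below are meant for b odd and positive and 0 <= a <= b - 1.
   Everything lives in Z, so that subtraction is not truncated; Z.div by 2 is
   the floor of the half. *)
Definition mab (a b : Z) : Z := Z.max 0 (a - (b - 1) / 2).

Definition Rab (a b r : Z) : Prop :=
  exists k : Z, (mab a b <= k <= a / 2)%Z /\ r = (a - 2 * k)%Z.

(* In Fab the denominator s is positive: k <= a / 2 gives r >= 0, and
   s >= r + 1. *)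
Definition Fab (a b : Z) (q : R) : Prop :=
  exists r s : Z,
    Rab a b r /\ (r + 1 <= s <= b - a)%Z /\ Z.Odd (s - r) /\
    q = IZR r / IZR s /\ 0 <= q < 1.

Definition Fb (b : Z) (q : R) : Prop :=
  exists a : Z, (0 <= a <= (b - 1) / 2)%Z /\ Fab a b q.

(* The ratio x / y belongs to S in absolute value; x / 0 belongs to no set,
   whereas Stdlib's division is total. *)
Definition abs_ratio_in (S : R -> Prop) (x y : R) : Prop :=
  y <> 0 /\ S (Rabs (x / y)).

(* Main.v *)
Require Import Defs.
From Stdlib Require Import Reals ZArith List Lia Lra Classical.
From Coquelicot Require Import Coquelicot.

(** Multiplying [cos (w x)] by [cos (alpha x) - cos (beta x)] produces, with
    weight [1/2] each, the cosines of frequencies [w + alpha], [w - alpha] with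
    sign [+] and [w + beta], [w - beta] with sign [-].  Hence the [p]-th power
    is [2 ^ (- p)] times the sum, over the [4 ^ p] nearest-neighbour walks of
    length [p] in the lattice [Z * Z] from the origin, of
    [(-1) ^ m * cos ((n * alpha + m * beta) * x)], where [(n, m)] is the end of
    the walk ([cos_diff_pow_walk_sum]).

    Separate the mean value [M] of this trigonometric sum from the rest, whose
    frequencies do not vanish and which therefore has a bounded antiderivative.
    By Dirichlet's test the rest divided by [x] has a convergent integral at
    infinity, while [M / x] integrates to [M * ln x]; at [0] the integrand is
    continuous.  So the integral converges exactly when [M = 0]
    ([improper_converges_iff_mean_zero]).

    The mean collects the walks ending at a resonance
    [n * alpha + m * beta = 0].  No cancellation occurs among them: as [p] is
    odd, [n + m] is odd, and two lattice points on one line through the origin,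
    both with odd coordinate sum, have second coordinates of the same parity
    ([resonant_same_sign]).  So [M <> 0] exactly when a resonance can be reached
    in [p] steps ([mean_zero_iff]).

    The reachable points are those with [|n| + |m| <= p] and [n + m] of the
    parity of [p] ([in_walk_ends]).  On the other side, the sets defining
    [Fb p] amount to the fractions [r / s] with [0 <= r < s], [r + s <= p] and
    [r + s] odd ([Fb_iff]).  With [r = |m|] and [s = |n|] these
    descriptions agree ([resonant_iff_ratio]). *)

Open Scope R_scope.

(** * Dirichlet's test with a mean value *)

Lemma derive_nonneg_increasing (f df : R -> R) (u v : R) :
  (forall x, 0 < x -> is_derive f x (df x)) ->
  (forall x, 0 < x -> 0 <= df x) ->
  0 < u <= v -> f u <= f v.
Proof.
  intros hf hdf huv.
  destruct (MVT_gen f u v df) as [c [hc e]].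
  - intros x hx. rewrite Rmin_left in hx by lra. apply hf; lra.
  - intros x hx. rewrite Rmin_left in hx by lra.
    apply continuity_pt_filterlim, (ex_derive_continuous f).
    exists (df x). apply hf; lra.
  - rewrite Rmin_left in hc by lra.
    assert (0 <= df c) by (apply hdf; lra). nra.
Qed.

(** Integration by parts: subtracting [B x / x] as well leaves a function [S]
    whose derivative is [B x / x ^ 2], bounded by [K / x ^ 2].  So both
    [S - K / x] and [- S - K / x] are increasing, and no integral has to be
    written. *)
Lemma dirichlet_estimate (G b B : R -> R) (M K : R) :
  (forall x, 0 < x -> is_derive G x ((M + b x) / x)) ->
  (forall x, is_derive B x (b x)) ->
  (forall x, Rabs (B x) <= K) ->
  forall u v, 0 < u <= v ->
    Rabs ((G v - M * ln v) - (G u - M * ln u)) <= 3 * K / u.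
Proof.
  intros hG hB hK u v huv.
  assert (hK' : forall x, - K <= B x <= K) by (intro x; apply Rabs_le_between, hK).
  pose (S := fun x => G x - M * ln x - B x / x).
  (* The values e = 1 and e = -1 give the two monotone functions. *)
  assert (hS : forall e x, 0 < x ->
    is_derive (fun y => e * S y - K / y) x ((K + e * B x) / x ^ 2)).
  { intros e x hx.
    unfold S. auto_derive.
    - repeat split; try lra.
      + eexists; now apply hG.
      + eexists; now apply hB.
    - rewrite (is_derive_unique (fun y : R => G y) _ _ (hG x hx)), (is_derive_unique (fun y : R => B y) _ _ (hB x)).
      field; lra. }
  assert (hmono : forall e, e = 1 \/ e = -1 ->
    e * S u - K / u <= e * S v - K / v).
  { intros e he.
    apply (derive_nonneg_increasing _ _ u v (hS e)); [|exact huv].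
    intros x hx. apply Rdiv_le_0_compat; [|nra].
    specialize (hK' x). destruct he; subst e; lra. }
  pose proof (hmono 1 (or_introl eq_refl)) as h1.
  pose proof (hmono (-1) (or_intror eq_refl)) as h2.
  unfold S in h1, h2.
  assert (0 < / v) by (apply Rinv_0_lt_compat; lra).
  assert (/ v <= / u) by (apply Rinv_le_contravar; lra).
  pose proof (hK' u). pose proof (hK' v).
  unfold Rdiv in *. apply Rabs_le_between. nra.
Qed.

(** If [M <> 0], the primitive stays within a bounded distance of the unbounded
    function [M * ln]; if [M = 0], the estimate is Cauchy's criterion at
    infinity.  Continuity of [f] on the whole line settles the endpoint [0]. *)
Lemma improper_converges_iff_mean_zero (f b B : R -> R) (M K : R) :
  (forall x, continuous f x) ->
  (forall x, 0 < x -> f x = (M + b x) / x) ->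
  (forall x, is_derive B x (b x)) ->
  (forall x, Rabs (B x) <= K) ->
  improper_converges f <-> M = 0.
Proof.
  intros hc hf hB hK.
  pose (G := fun x => RInt f 0 x).
  assert (hex : forall u v, ex_RInt f u v).
  { intros u v. apply (ex_RInt_continuous f). intros; apply hc. }
  assert (hG : forall x, is_derive G x (f x)).
  { intro x. apply (is_derive_RInt f G 0 x); [|apply hc].
    apply filter_forall. intro y. apply (RInt_correct f), hex. }
  assert (est : forall u v, 0 < u <= v ->
    Rabs ((G v - M * ln v) - (G u - M * ln u)) <= 3 * K / u).
  { apply (dirichlet_estimate G b B); trivial.
    intros x hx. rewrite <- hf by exact hx. apply hG. }
  assert (hK0 : 0 <= K) by (eapply Rle_trans; [apply Rabs_pos | apply (hK 0)]).
  split.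
  - intros [l hl].
    destruct (hl (ball l 1)) as [Q P hQ [N hN] h].
    { exists (mkposreal 1 Rlt_0_1). now intros. }
    destruct (filter_ex (F := at_right 0) Q hQ) as [a ha].
    destruct (Req_dec M 0) as [e|hM]; [exact e|exfalso].
    assert (hA : 0 < Rabs M) by now apply Rabs_pos_lt.
    (* At v, |M| ln v exceeds C, the bound on |M ln v| that the estimate from 1
       and a value of the integral within 1 of the limit l would impose. *)
    pose (C := Rabs (G 1) + 3 * K + Rabs l + 1 + Rabs (G a)).
    pose (v := Rmax (N + 1) (Rmax 1 (exp (C / Rabs M + 1)))).
    assert (hv1 : N < v) by (unfold v; pose proof (Rmax_l (N + 1) (Rmax 1 (exp (C / Rabs M + 1)))); lra).
    assert (hv2 : 1 <= v /\ exp (C / Rabs M + 1) <= v).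
    { unfold v. pose proof (Rmax_r (N + 1) (Rmax 1 (exp (C / Rabs M + 1)))).
      pose proof (Rmax_l 1 (exp (C / Rabs M + 1))).
      pose proof (Rmax_r 1 (exp (C / Rabs M + 1))). lra. }
    destruct (h a v ha (hN v hv1)) as [y [hy hb]]. simpl in hy.
    assert (ey : y = G v - G a).
    { rewrite <- (is_RInt_unique _ _ _ _ hy).
      pose proof (RInt_Chasles f 0 a v (hex _ _) (hex _ _)) as hh.
      unfold plus in hh; simpl in hh. unfold G. lra. }
    assert (hb' : Rabs (y - l) < 1) by exact hb.
    pose proof (est 1 v ltac:(lra)) as e1.
    rewrite ln_1 in e1.
    assert (hln : C / Rabs M + 1 <= ln v).
    { rewrite <- (ln_exp (C / Rabs M + 1)). apply ln_le; [apply exp_pos | apply hv2]. }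
    assert (hlow : C < Rabs (M * ln v)).
    { rewrite Rabs_mult, (Rabs_pos_eq (ln v)).
      - apply Rlt_le_trans with (Rabs M * (C / Rabs M + 1)); [|nra].
        replace (Rabs M * (C / Rabs M + 1)) with (C + Rabs M) by (field; lra). lra.
      - rewrite <- ln_1. apply ln_le; lra. }
    revert hlow e1 hb'. rewrite ey. unfold C.
    replace (3 * K / 1) with (3 * K) by field.
    unfold Rabs; repeat destruct Rcase_abs; lra.
  - intros eM.
    assert (hcv : exists L : R, filterlim G (Rbar_locally p_infty) (locally L)).
    { apply (proj1 (filterlim_locally_cauchy (U := R_CompleteSpace) (F := Rbar_locally p_infty) G)).
      intros eps.
      exists (fun x => 3 * K / eps + 1 < x). split.
      { now exists (3 * K / eps + 1). }
      assert (main : forall u v, 3 * K / eps + 1 < u -> u <= v -> Rabs (G v - G u) < eps).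
      { intros u v hu huv. destruct eps as [e he]; simpl in *.
        assert (0 <= 3 * K / e) by (apply Rdiv_le_0_compat; lra).
        pose proof (est u v ltac:(lra)) as h. rewrite eM in h.
        replace (G v - G u) with (G v - 0 * ln v - (G u - 0 * ln u)) by ring.
        apply Rle_lt_trans with (1 := h).
        apply Rlt_div_l; [lra|].
        assert (3 * K = e * (3 * K / e)) by (field; lra). nra. }
      intros u v hu hv. change (Rabs (G v - G u) < eps).
      destruct (Rle_dec u v); [now apply main|].
      rewrite Rabs_minus_sym. apply main; lra. }
    (* The integral is G at infinity minus G 0. *)
    destruct hcv as [L hL]. exists (L - 0).
    apply (is_RInt_gen_ext (Derive G)).
    { apply filter_forall. intros ab x _. apply is_derive_unique, hG. }
    apply is_RInt_gen_Derive.
    + apply filter_forall. intros ab x _. eexists; apply hG.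
    + apply filter_forall. intros ab x _.
      apply (continuous_ext f); [|apply hc].
      intro y. symmetry. apply is_derive_unique, hG.
    + apply (filterlim_filter_le_1 G (F := locally 0) (G := at_right 0)).
      * apply filter_le_within.
      * assert (e0 : G 0 = 0) by apply (RInt_point (V := R_CompleteNormedModule)).
        rewrite <- e0 at 2. apply (ex_derive_continuous G). eexists; apply hG.
    + exact hL.
Qed.

(** * Continuity of the integrand *)

(** The quotient [D x / x] is the difference quotient at [0], which tends to
    [D' 0 = 0]; this is also its value at [0], since [0 * / 0 = 0]. *)
Lemma continuous_quotient_at_flat_zero (D : R -> R) :
  D 0 = 0 -> is_derive D 0 0 -> continuous (fun x => D x / x) 0.
Proof.
  intros h0 hD. apply is_derive_Reals in hD.
  apply continuity_pt_filterlim. intros eps heps.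
  destruct (hD eps heps) as [d hd]. exists d. split; [apply cond_pos|].
  intros x [[_ hx] hdx]. simpl in *. unfold R_dist in *.
  rewrite Rminus_0_r in hdx.
  specialize (hd x (fun e => hx (eq_sym e)) hdx).
  rewrite Rplus_0_l, h0 in hd.
  replace (D x / x - D 0 / 0) with ((D x - 0) / x - 0); [exact hd|].
  rewrite h0. unfold Rdiv. ring.
Qed.

(** One of the factors cancels the pole: it is even, hence vanishes at [0]
    together with its derivative. *)
Lemma continuous_integrand (alpha beta : R) (q : nat) (x : R) :
  continuous (fun x => (cos (alpha * x) - cos (beta * x)) ^ S q / x) x.
Proof.
  pose (D := fun x => cos (alpha * x) - cos (beta * x)).
  assert (hD : forall x, is_derive D x (beta * sin (beta * x) - alpha * sin (alpha * x))).
  { intro y. unfold D. auto_derive; [trivial|ring]. }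
  apply (continuous_ext (fun y => mult (D y ^ q) (D y / y))).
  { intro y. unfold D, mult, Rdiv; simpl. ring. }
  apply (continuous_mult (K := R_AbsRing)).
  - apply (ex_derive_continuous (fun y => D y ^ q)).
    unfold D. auto_derive. trivial.
  - destruct (Req_dec x 0) as [e|hx].
    + subst x. apply continuous_quotient_at_flat_zero.
      * unfold D. rewrite !Rmult_0_r. ring.
      * assert (h0 := hD 0).
        now rewrite !Rmult_0_r, sin_0, !Rmult_0_r, Rminus_diag in h0.
    + apply (ex_derive_continuous (fun y => D y / y)).
      unfold D. auto_derive. repeat split; trivial.
Qed.
(** * Finite sums over lists *)

Definition sum_over {A : Type} (f : A -> R) (l : list A) : R :=
  fold_right Rplus 0 (map f l).

Lemma sum_over_ext {A} (f g : A -> R) l :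
  (forall a, f a = g a) -> sum_over f l = sum_over g l.
Proof.
  intros h. unfold sum_over. f_equal. now apply map_ext.
Qed.

Lemma sum_over_scal {A} (c : R) (f : A -> R) l :
  sum_over (fun a => c * f a) l = c * sum_over f l.
Proof.
  induction l as [|a l IH]; unfold sum_over in *; simpl; [ring|].
  rewrite IH. ring.
Qed.

Lemma sum_over_flat_map {A B} (f : B -> R) (g : A -> list B) l :
  sum_over f (flat_map g l) = sum_over (fun a => sum_over f (g a)) l.
Proof.
  induction l as [|a l IH]; [reflexivity|].
  unfold sum_over in *; simpl. rewrite map_app, fold_right_app, <- IH.
  generalize (fold_right Rplus 0 (map f (flat_map g l))) as s. intro s.
  induction (map f (g a)) as [|y ys IHy]; simpl; [ring|].
  rewrite IHy. ring.
Qed.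

Lemma sum_over_nonneg {A} (f : A -> R) l :
  (forall a, In a l -> 0 <= f a) -> 0 <= sum_over f l.
Proof.
  induction l as [|a l IH]; intro h; unfold sum_over in *; simpl; [lra|].
  pose proof (h a (or_introl eq_refl)).
  assert (0 <= fold_right Rplus 0 (map f l)) by (apply IH; intros; apply h; now right).
  lra.
Qed.

Lemma sum_over_In {A} (f : A -> R) l a :
  (forall b, In b l -> 0 <= f b) -> In a l -> f a <= sum_over f l.
Proof.
  induction l as [|b l IH]; intros h ha; [destruct ha|].
  assert (hl : forall c, In c l -> 0 <= f c) by (intros; apply h; now right).
  pose proof (h b (or_introl eq_refl)) as hb.
  change (sum_over f (b :: l)) with (f b + sum_over f l).
  destruct ha as [e|ha].
  - subst b. pose proof (sum_over_nonneg f l hl). lra.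
  - specialize (IH hl ha). lra.
Qed.

Lemma sum_over_zero {A} (f : A -> R) l :
  (forall a, In a l -> f a = 0) -> sum_over f l = 0.
Proof.
  induction l as [|a l IH]; intro h; [reflexivity|].
  change (sum_over f (a :: l)) with (f a + sum_over f l).
  rewrite (h a (or_introl eq_refl)), IH; [ring|]. intros; apply h; now right.
Qed.

(** * Trigonometric sums: mean and oscillating part *)

(** The mean value of [cos (w * x)] over the line. *)
Definition mean_part (w : R) : R := if Req_EM_T w 0 then 1 else 0.

Lemma cos_minus_mean_primitive (w : R) :
  exists B : R -> R, exists K : R,
    (forall x, is_derive B x (cos (w * x) - mean_part w)) /\
    (forall x, Rabs (B x) <= K).
Proof.
  unfold mean_part. destruct (Req_EM_T w 0) as [e|hw].
  - exists (fun _ => 0), 0. split.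
    + intro x. rewrite e, Rmult_0_l, cos_0, Rminus_diag. apply (is_derive_const 0).
    + intro x. rewrite Rabs_R0. lra.
  - exists (fun x => sin (w * x) / w), (/ Rabs w). split.
    + intro x. auto_derive; [trivial|]. field; exact hw.
    + intro x. unfold Rdiv. rewrite Rabs_mult, Rabs_inv.
      rewrite <- (Rmult_1_l (/ Rabs w)) at 2.
      apply Rmult_le_compat_r.
      * apply Rlt_le, Rinv_0_lt_compat, Rabs_pos_lt, hw.
      * apply Rabs_le_between. pose proof (SIN_bound (w * x)). lra.
Qed.

(** A trigonometric sum minus its mean meets the requirement of Dirichlet's
    test. *)
Lemma trig_sum_primitive {A} (c w : A -> R) (l : list A) :
  exists B : R -> R, exists K : R,
    (forall x, is_derive B x (sum_over (fun a => c a * cos (w a * x)) l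
                              - sum_over (fun a => c a * mean_part (w a)) l)) /\
    (forall x, Rabs (B x) <= K).
Proof.
  induction l as [|a l [B [K [hB hK]]]].
  - exists (fun _ => 0), 0. split.
    + intro x. unfold sum_over; simpl. rewrite Rminus_diag. apply (is_derive_const 0).
    + intro x. rewrite Rabs_R0. lra.
  - destruct (cos_minus_mean_primitive (w a)) as [B' [K' [hB' hK']]].
    exists (fun x => c a * B' x + B x), (Rabs (c a) * K' + K). split.
    + intro x. unfold sum_over in *; simpl.
      auto_derive.
      * repeat split; [eexists; apply hB' | eexists; apply hB].
      * rewrite (is_derive_unique (fun y : R => B y) _ _ (hB x)), (is_derive_unique (fun y : R => B' y) _ _ (hB' x)). ring.
    + intro x. eapply Rle_trans; [apply Rabs_triang|].
      rewrite Rabs_mult. pose proof (Rabs_pos (c a)).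
      pose proof (hK x). pose proof (hK' x). nra.
Qed.

(** * Expanding the power over lattice walks *)

(** A lattice point [(n, m)] stands for the frequency [n * alpha + m * beta];
    keeping the pair rather than the real number retains the parity of [m],
    which decides the sign. *)
Definition neighbours (v : Z * Z) : list (Z * Z) :=
  let (n, m) := v in
  ((n + 1, m) :: (n - 1, m) :: (n, m + 1) :: (n, m - 1) :: nil)%Z.

(** Ends are listed with multiplicity, one entry for each walk of length [p]. *)
Fixpoint walk_ends (p : nat) : list (Z * Z) :=
  match p with
  | O => (0, 0)%Z :: nil
  | S q => flat_map neighbours (walk_ends q)
  end.

Definition parity_sign (m : Z) : R := if Z.even m then 1 else -1.

Definition frequency (alpha beta : R) (v : Z * Z) : R :=
  IZR (fst v) * alpha + IZR (snd v) * beta.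

Lemma parity_sign_succ m : parity_sign (m + 1) = - parity_sign m.
Proof.
  unfold parity_sign. rewrite Z.even_add. destruct (Z.even m); simpl; ring.
Qed.

Lemma parity_sign_pred m : parity_sign (m - 1) = - parity_sign m.
Proof.
  unfold parity_sign. rewrite Z.even_sub. destruct (Z.even m); simpl; ring.
Qed.

(** Each step is the product-to-sum formula; a step in the second coordinate
    flips the sign. *)
Lemma cos_diff_pow_walk_sum (alpha beta x : R) (p : nat) :
  (cos (alpha * x) - cos (beta * x)) ^ p =
  sum_over (fun v => parity_sign (snd v) / 2 ^ p * cos (frequency alpha beta v * x))
           (walk_ends p).
Proof.
  induction p as [|p IH].
  - unfold sum_over, frequency, parity_sign; simpl.
    rewrite !Rmult_0_l, Rplus_0_l, Rmult_0_l, cos_0. field.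
  - cbn [pow walk_ends]. rewrite IH, sum_over_flat_map, <- sum_over_scal.
    apply sum_over_ext. intros [n m].
    unfold sum_over, frequency; simpl.
    rewrite parity_sign_succ, parity_sign_pred, !plus_IZR, !minus_IZR.
    set (t := (IZR n * alpha + IZR m * beta) * x).
    replace (((IZR n + 1) * alpha + IZR m * beta) * x) with (t + alpha * x) by (unfold t; ring).
    replace (((IZR n - 1) * alpha + IZR m * beta) * x) with (t - alpha * x) by (unfold t; ring).
    replace ((IZR n * alpha + (IZR m + 1) * beta) * x) with (t + beta * x) by (unfold t; ring).
    replace ((IZR n * alpha + (IZR m - 1) * beta) * x) with (t - beta * x) by (unfold t; ring).
    rewrite !cos_plus, !cos_minus. field. apply pow_nonzero; lra.
Qed.

(** For the reachability half, the last step is chosen to come from a point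
    closer to the origin.  The origin itself is entered from [(0, 1)], which is
    within reach because parity then forces a walk of length at least 2. *)
Lemma in_walk_ends (p : nat) (n m : Z) :
  In (n, m) (walk_ends p) <->
  (Z.abs n + Z.abs m <= Z.of_nat p)%Z /\ Z.Even (n + m - Z.of_nat p).
Proof.
  revert n m. induction p as [|p IH]; intros n m; cbn [walk_ends].
  - split.
    + intros [e|[]]. injection e as <- <-. split; [lia|now exists 0%Z].
    + intros [h _]. left. f_equal; lia.
  - rewrite in_flat_map. split.
    + intros [[n' m'] [h1 h2]]. apply IH in h1. destruct h1 as [h1 [k hk]].
      simpl in h2.
      destruct h2 as [e|[e|[e|[e|[]]]]]; injection e as <- <-; split; try lia.
      * now exists k; lia.
      * now exists (k - 1)%Z; lia.
      * now exists k; lia.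
      * now exists (k - 1)%Z; lia.
    + intros [h [k hk]].
      destruct (Z_lt_le_dec 0 n) as [hn|hn].
      { exists (n - 1, m)%Z. split.
        - apply IH. split; [lia|]. exists k; lia.
        - simpl. left. f_equal; lia. }
      destruct (Z_lt_le_dec n 0) as [hn'|hn'].
      { exists (n + 1, m)%Z. split.
        - apply IH. split; [lia|]. exists (k + 1)%Z; lia.
        - simpl. right; left. f_equal; lia. }
      destruct (Z_le_gt_dec m 0) as [hm|hm].
      * exists (n, m + 1)%Z. split.
        -- apply IH. split; [lia|]. exists (k + 1)%Z; lia.
        -- simpl. right; right; right; left. f_equal; lia.
      * exists (n, m - 1)%Z. split.
        -- apply IH. split; [lia|]. exists k; lia.
        -- simpl. right; right; left. f_equal; lia.
Qed.

(** * No cancellation in the mean *)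

Definition resonant (alpha beta : R) (p : nat) : Prop :=
  exists v, In v (walk_ends p) /\ frequency alpha beta v = 0.

Lemma walk_ends_odd p n m :
  Nat.Odd p -> In (n, m) (walk_ends p) -> Z.Odd (n + m).
Proof.
  intros [q hq] h. apply in_walk_ends in h. destruct h as [_ [k hk]].
  exists (k + Z.of_nat q)%Z. lia.
Qed.

(** Both points lie on the same line through the origin, so [n * m' = n' * m].
    If [m] and [m'] had different parities, the oddness of [n + m] and
    [n' + m'] would make one side of this equation odd and the other even. *)
Lemma resonant_same_sign (alpha beta : R) (n m n' m' : Z) :
  (alpha <> 0 \/ beta <> 0) ->
  Z.Odd (n + m) -> Z.Odd (n' + m') ->
  frequency alpha beta (n, m) = 0 -> frequency alpha beta (n', m') = 0 ->
  parity_sign m = parity_sign m'.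
Proof.
  unfold frequency; simpl. intros h0 ho ho' h h'.
  assert (e : (n * m' = n' * m)%Z).
  { apply eq_IZR. rewrite !mult_IZR.
    assert (ea : alpha * (IZR n * IZR m' - IZR n' * IZR m) = 0).
    { replace (alpha * (IZR n * IZR m' - IZR n' * IZR m)) with
        (IZR m' * (IZR n * alpha + IZR m * beta) - IZR m * (IZR n' * alpha + IZR m' * beta))
        by ring. rewrite h, h'. ring. }
    assert (eb : beta * (IZR n * IZR m' - IZR n' * IZR m) = 0).
    { replace (beta * (IZR n * IZR m' - IZR n' * IZR m)) with
        (IZR n * (IZR n' * alpha + IZR m' * beta) - IZR n' * (IZR n * alpha + IZR m * beta))
        by ring. rewrite h, h'. ring. }
    destruct h0 as [h0|h0].
    - apply Rmult_integral in ea. destruct ea; [contradiction|lra].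
    - apply Rmult_integral in eb. destruct eb; [contradiction|lra]. }
  apply (f_equal Z.even) in e. rewrite !Z.even_mul in e.
  rewrite <- Z.odd_spec, Z.odd_add, <- !Z.negb_even in ho, ho'.
  unfold parity_sign.
  destruct (Z.even n), (Z.even m), (Z.even n'), (Z.even m'); simpl in *; congruence.
Qed.

Lemma mean_zero_iff (alpha beta : R) (p : nat) :
  (alpha <> 0 \/ beta <> 0) -> Nat.Odd p ->
  sum_over (fun v => parity_sign (snd v) / 2 ^ p * mean_part (frequency alpha beta v))
           (walk_ends p) = 0
  <-> ~ resonant alpha beta p.
Proof.
  intros h0 hp. split.
  - intros hs [[n m] [hin hw]].
    (* Multiplied by the sign of one resonance, all terms are nonnegative and
       that resonance contributes 2 ^ - p. *)
    set (f := fun v => _) in hs.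
    assert (h2 : 0 < / 2 ^ p) by (apply Rinv_0_lt_compat, pow_lt; lra).
    assert (hsq : forall k, parity_sign k * parity_sign k = 1)
      by (intro k; unfold parity_sign; destruct (Z.even k); ring).
    assert (hle := sum_over_In (fun v => parity_sign m * f v) (walk_ends p) (n, m)).
    rewrite sum_over_scal, hs in hle.
    assert (hm : parity_sign m * f (n, m) = / 2 ^ p).
    { unfold f, mean_part. rewrite hw. destruct (Req_EM_T 0 0); [|lra].
      simpl. unfold Rdiv. rewrite Rmult_1_r, <- Rmult_assoc, hsq. ring. }
    rewrite hm in hle.
    enough (/ 2 ^ p <= parity_sign m * 0) by lra.
    apply hle; [|exact hin].
    intros [n' m'] hin'. unfold f, mean_part.
    destruct (Req_EM_T (frequency alpha beta (n', m')) 0) as [hw'|_]; [|lra].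
    simpl. rewrite (resonant_same_sign alpha beta n m n' m'); trivial;
      try (now apply (walk_ends_odd p)).
    unfold Rdiv. rewrite Rmult_1_r, <- Rmult_assoc, hsq. lra.
  - intros hn. apply sum_over_zero. intros v hv. unfold mean_part.
    destruct (Req_EM_T _ _) as [e|_]; [|ring].
    exfalso. apply hn. now exists v.
Qed.

(** * Resonances and the set of ratios *)

(** For [a <= (b - 1) / 2] the lower bound on [k] is [0], so [r <= a], and the
    constraint [s <= b - a] is weakest for [a = r]: this choice of [a] captures
    every fraction. *)
Lemma Fb_iff (p : nat) (q : R) : Nat.Odd p ->
  Fb (Z.of_nat p) q <->
  exists r s : Z, (0 <= r < s /\ r + s <= Z.of_nat p)%Z /\ Z.Odd (r + s) /\ q = IZR r / IZR s.
Proof.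
  intros [t ht].
  assert (hhalf : ((Z.of_nat p - 1) / 2 = Z.of_nat t)%Z).
  { replace (Z.of_nat p - 1)%Z with (Z.of_nat t * 2)%Z by lia. now apply Z.div_mul. }
  unfold Fb, Fab, Rab, mab. rewrite hhalf. split.
  - intros [a [ha [r [s [[k [hk er]] [hs [[j hj] [eqq _]]]]]]]].
    assert (2 * (a / 2) <= a)%Z by (apply Z.mul_div_le; lia).
    exists r, s. repeat split; try lia; [|exact eqq].
    exists (j + r)%Z. lia.
  - intros [r [s [[hrs hp] [[j hj] eqq]]]].
    exists r. split; [lia|]. exists r, s. repeat split; try lia.
    + exists 0%Z. repeat split; try lia. apply Z.div_pos; lia.
    + exists (j - r)%Z. lia.
    + exact eqq.
    + rewrite eqq. apply Rdiv_le_0_compat; [apply IZR_le; lia | apply IZR_lt; lia].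
    + rewrite eqq. apply Rlt_div_l; [apply IZR_lt; lia|]. rewrite Rmult_1_l. apply IZR_lt; lia.
Qed.

Lemma resonant_sym alpha beta p : resonant alpha beta p -> resonant beta alpha p.
Proof.
  intros [[n m] [h e]]. exists (m, n). split.
  - apply in_walk_ends in h. apply in_walk_ends.
    rewrite (Z.add_comm (Z.abs m)), (Z.add_comm m). exact h.
  - unfold frequency in *; simpl in *. lra.
Qed.

(** A resonance says [|n| * |alpha| = |m| * |beta|], and [|alpha| < |beta|]
    forces [|m| < |n|]. *)
Lemma resonant_iff_ratio (alpha beta : R) (p : nat) :
  Nat.Odd p -> Rabs alpha < Rabs beta ->
  resonant alpha beta p <-> abs_ratio_in (Fb (Z.of_nat p)) alpha beta.
Proof.
  intros hp hlt. unfold abs_ratio_in. rewrite Fb_iff by exact hp.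
  assert (hb : beta <> 0).
  { intros e. rewrite e, Rabs_R0 in hlt. pose proof (Rabs_pos alpha). lra. }
  assert (hb' : 0 < Rabs beta) by now apply Rabs_pos_lt.
  split.
  - intros [[n m] [hin hw]]. split; [exact hb|].
    pose proof (walk_ends_odd p n m hp hin) as [j hj].
    apply in_walk_ends in hin. destruct hin as [hle _].
    assert (e : IZR (Z.abs n) * Rabs alpha = IZR (Z.abs m) * Rabs beta).
    { rewrite !abs_IZR, <- !Rabs_mult. unfold frequency in hw; simpl in hw.
      replace (IZR n * alpha) with (- (IZR m * beta)) by lra. apply Rabs_Ropp. }
    assert (hn : n <> 0%Z).
    { intros en. rewrite en, Rmult_0_l in e. symmetry in e.
      apply Rmult_integral in e. destruct e as [e|e]; [|lra].
      apply eq_IZR in e. lia. }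
    assert (hn' : 0 < IZR (Z.abs n)) by (apply IZR_lt; lia).
    exists (Z.abs m), (Z.abs n). repeat split; try lia.
    + apply lt_IZR. assert (0 <= IZR (Z.abs m)) by (apply IZR_le; lia). nra.
    + destruct (Z.abs_eq_or_opp n) as [->| ->], (Z.abs_eq_or_opp m) as [->| ->].
      * exists j; lia.
      * exists (j - m)%Z; lia.
      * exists (j - n)%Z; lia.
      * exists (- j - 1)%Z; lia.
    + unfold Rdiv at 1. rewrite Rabs_mult, Rabs_inv.
      apply Rmult_eq_reg_r with (IZR (Z.abs n) * Rabs beta); [|nra].
      field_simplify; lra.
  - intros [_ [r [s [[hrs hle] [hodd e]]]]].
    destruct hp as [t ht], hodd as [j hj].
    assert (hs : 0 < IZR s) by (apply IZR_lt; lia).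
    assert (hr : 0 <= IZR r) by (apply IZR_le; lia).
    assert (hab : IZR s * Rabs alpha = IZR r * Rabs beta).
    { unfold Rdiv at 1 in e. rewrite Rabs_mult, Rabs_inv in e.
      replace (Rabs alpha) with (IZR r / IZR s * Rabs beta); [field; lra|].
      rewrite <- e. field. lra. }
    assert (hin : forall u, u = r \/ u = (- r)%Z -> In (s, u) (walk_ends p)).
    { intros u hu. apply in_walk_ends. split; [lia|].
      destruct hu as [->| ->].
      - exists (j - Z.of_nat t)%Z. lia.
      - exists (j - Z.of_nat t - r)%Z. lia. }
    assert (hx : IZR s * alpha = IZR r * beta \/ IZR s * alpha = - (IZR r * beta)).
    { revert hab. unfold Rabs. repeat destruct Rcase_abs; intros; lra. }
    destruct hx as [hx|hx].
    + exists (s, - r)%Z. split; [apply hin; now right|].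
      unfold frequency; simpl. rewrite opp_IZR. lra.
    + exists (s, r). split; [apply hin; now left|].
      unfold frequency; simpl. lra.
Qed.

(** Fractions in [Fb] are less than 1, so of the two alternatives of the theorem
    only the one with the smaller modulus on top can hold. *)
Lemma abs_ratio_lt (alpha beta : R) (p : nat) :
  Nat.Odd p -> abs_ratio_in (Fb (Z.of_nat p)) alpha beta -> Rabs alpha < Rabs beta.
Proof.
  intros hp [hb h]. apply Fb_iff in h; [|exact hp].
  destruct h as [r [s [[hrs _] [_ e]]]].
  assert (hb' : 0 < Rabs beta) by now apply Rabs_pos_lt.
  assert (hs : 0 < IZR s) by (apply IZR_lt; lia).
  assert (hlt : Rabs (alpha / beta) < 1).
  { rewrite e. apply Rlt_div_l; [exact hs|]. rewrite Rmult_1_l. apply IZR_lt; lia. }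
  unfold Rdiv in hlt. rewrite Rabs_mult, Rabs_inv in hlt.
  apply Rlt_div_l in hlt; lra.
Qed.
Theorem theorem3p5 (alpha beta : R) (p : nat)
    (hab : Rabs alpha <> Rabs beta) (hp : Nat.Odd p) :
  improper_diverges
    (fun x : R => (cos (alpha * x) - cos (beta * x)) ^ p / x)
  <->
  (abs_ratio_in (Fb (Z.of_nat p)) alpha beta \/
   abs_ratio_in (Fb (Z.of_nat p)) beta alpha).

Proof.
  assert (h0 : alpha <> 0 \/ beta <> 0).
  { destruct (Req_dec alpha 0) as [ea|ha]; [right|now left].
    intros eb. apply hab. now rewrite ea, eb. }
  assert (hres : resonant alpha beta p <->
    (abs_ratio_in (Fb (Z.of_nat p)) alpha beta \/
     abs_ratio_in (Fb (Z.of_nat p)) beta alpha)).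
  { destruct (Rtotal_order (Rabs alpha) (Rabs beta)) as [h|[h|h]]; [|contradiction|].
    - rewrite (resonant_iff_ratio alpha beta p hp h). split; [now left|].
      intros [k|k]; [exact k|]. apply abs_ratio_lt in k; [lra|exact hp].
    - assert (hs : resonant alpha beta p <-> resonant beta alpha p)
        by (split; apply resonant_sym).
      rewrite hs, (resonant_iff_ratio beta alpha p hp h). split; [now right|].
      intros [k|k]; [|exact k]. apply abs_ratio_lt in k; [lra|exact hp]. }
  rewrite <- hres.
  destruct (trig_sum_primitive (fun v => parity_sign (snd v) / 2 ^ p)
              (frequency alpha beta) (walk_ends p)) as [B [K [hB hK]]].
  set (M := sum_over (fun v => _ * mean_part _) _) in hB.
  assert (hconv : improper_converges
    (fun x : R => (cos (alpha * x) - cos (beta * x)) ^ p / x) <-> M = 0).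
  { apply (improper_converges_iff_mean_zero _ _ B M K) with (3 := hB); [| |exact hK].
    - destruct p as [|q]; [destruct hp; lia|]. intro x. apply continuous_integrand.
    - intros x _. rewrite cos_diff_pow_walk_sum. f_equal. ring. }
  assert (hM : M = 0 <-> ~ resonant alpha beta p) by now apply mean_zero_iff.
  unfold improper_diverges. rewrite hconv, hM.
  split; [apply NNPP | tauto].
Qed.
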